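(* Assume the Schanuel conjecture. Then: for every $b\in\overline{\mathbb{Q}}\setminus\{0,1\}$ and every nonzero value $\ln b$ of its logarithm, $\ln b\notin EL^{alg}$; in particular $\pi\notin EL^{alg}$ and $e\notin EL^{alg}$; and for every $a\in EL^{alg}\setminus\{0,1\}$, no value of $\ln a$ lies in $EL^{alg}$.
   Context: Schanuel conjecture: if $z_1,\dots,z_n\in\mathbb{C}$ are linearly independent over $\mathbb{Q}$, then at least $n$ of $z_1,\dots,z_n,e^{z_1},\dots,e^{z_n}$ are algebraically independent over $\mathbb{Q}$. For $b\in\mathbb{C}\setminus\{0,1\}$ fix a nonzero value $\ln b$ and define $b^x:=e^{x\ln b}$. For $S\subseteq\mathbb{C}$ let $b^{S}=\{b^x:x\in S\}$ and $\mathrm{Log}_b(S)=\{w: b^w\in S\}$. $\overline{F}$ is the algebraic closure in $\mathbb{C}$ of a field $F$. Define $EL_0:=\mathbb{Q}$, $EL_n:=\overline{EL_{n-1}\big(b^{EL_{n-1}},\mathrm{Log}_b(EL_{n-1})\big)}$, $EL^{(b)}:=\bigcup_{n\ge0}EL_n$; equivalently the smallest algebraically closed subfield $F\subseteq\mathbb{C}$ with $x\in F\iff b^x\in F$. $EL^{alg}:=EL^{(-1)}$ with $\ln(-1)=i\pi$; it equals $EL^{(b)}$ for every algebraic $b\ne0,1$ (any choice of $\ln b$). Its elements are the algebraically based numbers. *)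

(* Defs.v *)
From HB Require Import structures.
From mathcomp Require Import all_boot all_order all_algebra.
From mathcomp Require Import reals sequences exp trigo.
From mathcomp Require Import complex.
From mathcomp Require Import mpoly.

Set Implicit Arguments.
Unset Strict Implicit.
Unset Printing Implicit Defensive.

Import Order.TTheory GRing.Theory Num.Theory.
Local Open Scope ring_scope.
Local Open Scope complex_scope.

Section EL.
Variable R : realType.

Definition Cexp (z : R[i]) : R[i] :=
  let: x +i* y := z in (expR x * cos y) +i* (expR x * sin y).

(* the fixed logarithm ln(-1) = i*pi *)
Definition ipi : R[i] := 0 +i* pi.

(* b^x := e^{x ln b} for b = -1, ln b = i pi *)
Definition bpow (x : R[i]) : R[i] := Cexp (x * ipi).

Definition is_subfield (F : R[i] -> Prop) : Prop :=
  [/\ F 0, F 1,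
      (forall x y, F x -> F y -> F (x - y)),
      (forall x y, F x -> F y -> F (x * y)) &
      (forall x, F x -> x != 0 -> F x^-1)].

Definition gen_field (S : R[i] -> Prop) : R[i] -> Prop :=
  fun z => forall F, is_subfield F -> (forall x, S x -> F x) -> F z.

Definition alg_closure (F : R[i] -> Prop) : R[i] -> Prop :=
  fun z => exists p : {poly R[i]},
      [/\ p != 0, (forall k, F p`_k) & root p z].

Fixpoint EL_ (n : nat) : R[i] -> Prop :=
  match n with
  | 0 => fun z => exists q : rat, z = ratr q
  | n'.+1 =>
      alg_closure (gen_field (fun x =>
          [\/ EL_ n' x,
              (exists y, EL_ n' y /\ x = bpow y) |
              EL_ n' (bpow x)]))
  end.

(* EL^alg = EL^{(-1)}, with ln(-1) = i pi: the algebraically based numbers *)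
Definition ELalg (z : R[i]) : Prop := exists n, EL_ n z.

Definition algebraicQ (z : R[i]) : Prop :=
  exists p : {poly rat}, p != 0 /\ root (map_poly (ratr : rat -> R[i]) p) z.

Definition Qlin_indep (n : nat) (z : 'I_n -> R[i]) : Prop :=
  forall c : 'I_n -> rat,
    \sum_(i < n) ratr (c i) * z i = 0 -> forall i, c i = 0.

Definition Qalg_indep (n : nat) (x : 'I_n -> R[i]) : Prop :=
  forall p : mpoly.mpoly n rat,
    mpoly.meval x (mpoly.map_mpoly (ratr : rat -> R[i]) p) = 0 -> p = 0.

Definition Schanuel : Prop :=
  forall (n : nat) (z : 'I_n -> R[i]), Qlin_indep z ->
    exists s : 'I_n -> 'I_n + 'I_n,
      injective s /\
      Qalg_indep (fun k => match s k with
                           | inl i => z i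
                           | inr i => Cexp (z i)
                           end).

End EL.

(* Main.v *)
Require Import Defs.
From HB Require Import structures.
From mathcomp Require Import all_boot all_order all_algebra.
From mathcomp Require Import boolp reals sequences exp trigo.
From mathcomp Require Import complex mpoly ring.

Set Implicit Arguments.
Unset Strict Implicit.
Unset Printing Implicit Defensive.

Import Order.TTheory GRing.Theory Num.Theory.
Local Open Scope ring_scope.
Local Open Scope complex_scope.

(**
Everything reduces to [i pi] not being algebraically based: if [L] and [e^L]
both are, then so is [x = L / (i pi)], because [(-1)^x = e^L], and
[i pi = L / x].

An algebraically based number lies in the algebraic closure [K] of
[Q(x_1, (-1)^x_1, ..., x_n, (-1)^x_n)], where at each step exactly one of [x_j],
[(-1)^x_j] already lies in the previous field. Hence [K] has transcendence
degree at most [n]. The [x] such that [x] and [(-1)^x] both lie in a given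
algebraically closed field form a Q-vector space containing [1], so
[1, x_1, ..., x_n] are linearly independent over [Q]. Schanuel's conjecture
applied to [i pi, i pi x_1, ..., i pi x_n] gives [n + 1] algebraically
independent numbers, all of them in [K] as soon as [i pi] is: a contradiction.
*)

(** * Subfields as field types, and algebraic elements as integral elements *)

Section SubfieldType.
Variables (R : realType) (F : R[i] -> Prop).
Hypothesis sF : is_subfield F.

(** Packing [F] as a field type makes the theory of integral elements applicable to a [Prop]-valued
    subfield. *)
Definition subfield_pred : {pred R[i]} := fun x => `[< F x >].

Lemma subfield_divring_closed : divring_closed subfield_pred.
Proof.
case: sF => F0 F1 FB FM FV; split.
- exact/asboolP.
- by move=> x y /asboolP Fx /asboolP Fy; apply/asboolP/FB.
- move=> x y /asboolP Fx /asboolP Fy; apply/asboolP.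
  by have [->|y0] := eqVneq y 0; [rewrite invr0 mulr0 | apply/FM/FV].
Qed.

HB.instance Definition _ :=
  GRing.isDivringClosed.Build R[i] subfield_pred subfield_divring_closed.

Definition subfield_type : Type := {x : R[i] | x \in subfield_pred}.
HB.instance Definition _ := SubChoice.on subfield_type.
HB.instance Definition _ :=
  [SubChoice_isSubIntegralDomain of subfield_type by <:].
HB.instance Definition _ := [SubIntegralDomain_isSubField of subfield_type by <:].

(** Over a field, algebraic and integral mean the same; the closure properties of integral elements
    can then be transferred to [alg_closure]. *)
Lemma alg_closure_integralOver z :
  alg_closure F z <-> integralOver (val : subfield_type -> R[i]) z.
Proof.
rewrite -integral_algebraic; split.
- case=> p [p0 Fp pz].
  have Fp' k : p`_k \in subfield_pred by apply/asboolP.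
  exists (\poly_(k < size p) (Sub p`_k (Fp' k) : subfield_type)).
    apply: contra_neq p0 => e; apply/polyP => k.
    have := congr1 (fun q : {poly subfield_type} => val q`_k) e.
    rewrite coef_poly coef0; case: ltnP => [_ /= ->|/(nth_default 0) ->] //.
    by rewrite coef0.
  suff -> : map_poly (val : subfield_type -> R[i])
     (\poly_(k < size p) (Sub p`_k (Fp' k) : subfield_type)) = p by [].
  apply/polyP => k; rewrite coef_map coef_poly.
  by case: ltnP => [_ //|/(nth_default 0) ->].
- case=> p p0 pz; exists (map_poly val p); split => //.
  + by rewrite map_poly_eq0.
  + by move=> k; rewrite coef_map; apply/asboolP/(valP p`_k).
Qed.

End SubfieldType.

Section AlgClosure.
Variable R : realType.
Implicit Types F S : R[i] -> Prop.

Lemma alg_closure_subfield F : is_subfield F -> is_subfield (alg_closure F).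
Proof.
move=> sF; split.
- by apply/(alg_closure_integralOver sF)/integral0.
- by apply/(alg_closure_integralOver sF)/integral1.
- move=> x y /(alg_closure_integralOver sF) ix /(alg_closure_integralOver sF) iy.
  exact/(alg_closure_integralOver sF)/integral_sub.
- move=> x y /(alg_closure_integralOver sF) ix /(alg_closure_integralOver sF) iy.
  exact/(alg_closure_integralOver sF)/integral_mul.
- move=> x /(alg_closure_integralOver sF) ix _.
  exact/(alg_closure_integralOver sF)/integral_inv.
Qed.

(** A root of a nonzero polynomial whose coefficients are integral over [F] is itself integral over
    [F]. *)
Lemma alg_closure_idem F z :
  is_subfield F -> alg_closure (alg_closure F) z -> alg_closure F z.
Proof.
move=> sF [p [p0 Fp pz]]; apply/(alg_closure_integralOver sF).
apply: (integral_root p0 pz); apply/integral_poly => k.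
exact/(alg_closure_integralOver sF).
Qed.
End AlgClosure.

(** * Closure properties of a subfield of the complex numbers *)

Section Subfield.
Variables (R : realType) (F : R[i] -> Prop).
Hypothesis sF : is_subfield F.

Lemma subfield0 : F 0. Proof. by case: sF. Qed.

Lemma subfield1 : F 1. Proof. by case: sF. Qed.

Lemma subfieldB x y : F x -> F y -> F (x - y).
Proof. by case: sF => ? ? + *; apply. Qed.

Lemma subfieldM x y : F x -> F y -> F (x * y).
Proof. by case: sF => ? ? ? + *; apply. Qed.

Lemma subfieldN x : F x -> F (- x).
Proof. by move=> Fx; rewrite -sub0r; apply: subfieldB (subfield0) Fx. Qed.

Lemma subfieldD x y : F x -> F y -> F (x + y).
Proof. by move=> Fx Fy; rewrite -[y]opprK; apply/subfieldB/subfieldN. Qed.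

Lemma subfieldV x : F x -> F x^-1.
Proof.
by have [->|x0] := eqVneq x 0; rewrite ?invr0 //; case: sF => ? ? ? ? + *; apply.
Qed.

Lemma subfield_sum I (r : seq I) (P : pred I) (f : I -> R[i]) :
  (forall i, P i -> F (f i)) -> F (\sum_(i <- r | P i) f i).
Proof. by move=> Ff; apply: (big_ind F) => //; [apply: subfield0|apply: subfieldD]. Qed.

Lemma subfieldX x n : F x -> F (x ^+ n).
Proof.
move=> Fx; elim: n => [|n IH]; first by rewrite expr0; apply: subfield1.
by rewrite exprS; apply: subfieldM.
Qed.

Lemma subfield_nat n : F n%:R.
Proof.
elim: n => [|n IH]; first exact: subfield0.
by rewrite -natr1; apply: subfieldD IH subfield1.
Qed.

Lemma subfield_int (m : int) : F m%:~R.
Proof.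
by case: m => n; [|rewrite NegzE mulrNz; apply: subfieldN]; apply: subfield_nat.
Qed.

Lemma subfield_rat (q : rat) : F (ratr q).
Proof. by apply/subfieldM/subfieldV; apply: subfield_int. Qed.

Lemma alg_closure_sub z : F z -> alg_closure F z.
Proof.
move=> Fz; exists ('X - z%:P); split; first by rewrite polyXsubC_eq0.
- move=> k; rewrite coefB coefX coefC; apply: subfieldB; first exact: subfield_nat.
  by case: ifP => // _; apply: subfield0.
- by rewrite root_XsubC.
Qed.

End Subfield.

(** * Algebraic dependence, Steinitz exchange and transcendence degree *)

Section GeneratedField.
Variable R : realType.
Implicit Types F S T A : R[i] -> Prop.

Lemma gen_field_sub S z : S z -> gen_field S z.
Proof. by move=> Sz F _; apply. Qed.

Lemma gen_field_subfield S : is_subfield (gen_field S).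
Proof.
split.
- by move=> F sF _; apply: subfield0.
- by move=> F sF _; apply: subfield1.
- by move=> x y Sx Sy F sF SF; apply: subfieldB => //; [apply: Sx|apply: Sy].
- by move=> x y Sx Sy F sF SF; apply: subfieldM => //; [apply: Sx|apply: Sy].
- by move=> x Sx _ F sF SF; apply: subfieldV => //; apply: Sx.
Qed.

(** Since [gen_field S] contains the rationals, this is the closure operator of algebraic dependence
    over Q. *)
Definition gen_closure S := alg_closure (gen_field S).

Lemma gen_closure_subfield S : is_subfield (gen_closure S).
Proof. exact/alg_closure_subfield/gen_field_subfield. Qed.

Lemma gen_closure_closed S z : alg_closure (gen_closure S) z -> gen_closure S z.
Proof. exact/alg_closure_idem/gen_field_subfield. Qed.

Lemma gen_closure_sub S z : S z -> gen_closure S z.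
Proof.
by move=> Sz; apply: (alg_closure_sub (gen_field_subfield S)); apply: gen_field_sub.
Qed.

Lemma alg_closure_mono F G z :
  (forall x, F x -> G x) -> alg_closure F z -> alg_closure G z.
Proof. by move=> FG [p [p0 Fp pz]]; exists p; split => // k; apply/FG. Qed.

Lemma gen_closure_min S F :
    is_subfield F -> (forall z, alg_closure F z -> F z) ->
  (forall x, S x -> F x) -> forall z, gen_closure S z -> F z.
Proof.
move=> sF cF SF z Sz; apply: cF; apply: alg_closure_mono Sz => x; exact.
Qed.

Lemma gen_closure_subset S T :
  (forall x, S x -> gen_closure T x) ->
  forall z, gen_closure S z -> gen_closure T z.
Proof.
apply: gen_closure_min; first exact: gen_closure_subfield.
exact: gen_closure_closed.
Qed.

Lemma gen_closure_mono S T :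
  (forall x, S x -> T x) -> forall z, gen_closure S z -> gen_closure T z.
Proof. by move=> ST; apply: gen_closure_subset => x /ST/gen_closure_sub. Qed.

Definition is_subring A :=
  [/\ A 1, (forall x y, A x -> A y -> A (x - y)) &
      (forall x y, A x -> A y -> A (x * y))].

(** The [z] admitting such a denominator [d] form the fraction field of [A], a subfield that
    contains [S] and hence [gen_field S]. *)
Lemma subring_fractions A S : is_subring A -> (forall x, S x -> A x) ->
  forall z, gen_field S z -> exists d, [/\ A d, d != 0 & A (d * z)].
Proof.
move=> [A1 AB AM] SA z Sz.
apply: (Sz (fun z => exists d, [/\ A d, d != 0 & A (d * z)])).
  have A0 : A 0 by rewrite -(subrr 1); apply: AB.
  split.
  - by exists 1; rewrite oner_eq0 mulr0.
  - by exists 1; rewrite oner_eq0 mulr1.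
  - move=> x y [d [Ad d0 Adx]] [e [Ae e0 Aey]]; exists (d * e).
    rewrite mulf_neq0 //; split=> //; first exact: AM.
    have -> : d * e * (x - y) = e * (d * x) - d * (e * y) by ring.
    by apply: AB; apply: AM.
  - move=> x y [d [Ad d0 Adx]] [e [Ae e0 Aey]]; exists (d * e).
    rewrite mulf_neq0 //; split=> //; first exact: AM.
    have -> : d * e * (x * y) = (d * x) * (e * y) by ring.
    exact: AM.
  (* [d * x] is a denominator of [x^-1], because [(d * x) * x^-1 = d] lies in [A]. *)
  - move=> x [d [Ad d0 Adx]] x0; exists (d * x).
    by rewrite mulf_neq0 // mulfK.
move=> x Sx; exists 1; rewrite oner_eq0 mul1r; split=> //; exact: SA.
Qed.

Lemma gen_closure_subring_root A S : is_subring A -> (forall x, S x -> A x) ->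
  forall z, gen_closure S z ->
  exists p : {poly R[i]}, [/\ p != 0, (forall k, A p`_k) & root p z].
Proof.
move=> rA SA z [p [p0 Sp pz]]; have [A1 AB AM] := rA.
have A0 : A 0 by rewrite -(subrr 1); apply: AB.
(* A common denominator of the coefficients of [p], built one coefficient at a time; multiplying [p]
   by it brings the equation into [A]. *)
have [d [Ad d0 Adp]] : exists d,
    [/\ A d, d != 0 & forall k, (k < size p)%N -> A (d * p`_k)].
  elim: (size p) => [|n [d [Ad d0 Adp]]]; first by exists 1; rewrite oner_eq0.
  have [e [Ae e0 Aep]] := subring_fractions rA SA (Sp n).
  exists (d * e); rewrite mulf_neq0 //; split=> //; first exact: AM.
  move=> k; rewrite ltnS leq_eqVlt => /orP[/eqP->|kn].
    by rewrite -mulrA; apply: AM.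
  by rewrite mulrAC; apply: AM => //; apply: Adp.
exists (d *: p); split; first by rewrite scaler_eq0 negb_or d0.
- move=> k; rewrite coefZ; have [/Adp //|/(nth_default 0) ->] := ltnP k (size p).
  by rewrite mulr0.
- by rewrite rootE hornerZ (rootP pz) mulr0.
Qed.

Definition adj S b := fun x : R[i] => S x \/ x = b.

(* Write an equation for [a] over [F(b)] as [sum_k q_k(b) a^k = 0] with
   [q_k] in [F[Y]]: as [a] is transcendental over [F], some coefficient of the
   polynomial [sum_k a^k q_k] in [Y] does not vanish, and [b] is a root. *)
Lemma gen_closure_exchange S a b :
  gen_closure (adj S b) a -> ~ gen_closure S a -> gen_closure (adj S a) b.
Proof.
move=> ab aS; have sF := gen_field_subfield S.
(* [A] is the ring F[b], where F is [gen_field S]. *)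
pose A x := exists2 q : {poly R[i]}, (forall k, gen_field S q`_k) & x = q.[b].
have rA : is_subring A.
  split.
  - exists 1; last by rewrite hornerC.
    by move=> k; rewrite coef1; apply: (subfield_nat sF).
  - move=> _ _ [p Fp ->] [q Fq ->]; exists (p - q); last by rewrite hornerD hornerN.
    by move=> k; rewrite coefB; apply: (subfieldB sF).
  - move=> _ _ [p Fp ->] [q Fq ->]; exists (p * q); last by rewrite hornerM.
    by move=> k; rewrite coefM; apply: (subfield_sum sF) => // i _; apply: (subfieldM sF).
have SA x : adj S b x -> A x.
  case=> [Sx|->].
    exists x%:P; last by rewrite hornerC.
    move=> k; rewrite coefC; case: ifP => _; last exact: (subfield0 sF).
    exact: gen_field_sub.
  by exists 'X; [move=> k; rewrite coefX; apply: subfield_nat|rewrite hornerX].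
have [p [p0 Ap pa]] := gen_closure_subring_root rA SA ab.
have [q Fq pq] : exists2 q : nat -> {poly R[i]},
    forall k j, gen_field S (q k)`_j & forall k, p`_k = (q k).[b].
  by have /choice[q qP] : forall k, exists q : {poly R[i]},
      (forall j, gen_field S q`_j) /\ p`_k = q.[b];
    [move=> k; have [q ? ?] := Ap k; exists q | exists q => k; case: (qP k)].
pose r := \sum_(k < size p) a ^+ k *: q k.
have sG := gen_field_subfield (adj S a).
have rb : root r b.
  rewrite rootE horner_sum; apply/eqP; rewrite -[RHS](rootP pa) horner_coef.
  by apply: eq_bigr => k _; rewrite hornerZ pq mulrC.
exists r; split=> //.
- apply/eqP => r0; apply: aS.
  (* The leading coefficient of [p] is nonzero, so its lift has a nonzero coefficient of some degree
     [j]. If [r] vanished, the degree [j] coefficients of all the [q k] would form an equation for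
     [a] over F. *)
  have [j qj0] : exists j, (q (size p).-1)`_j != 0.
    apply: contrapT => /forallNP q0; move: p0; rewrite -lead_coef_eq0 /lead_coef pq.
    suff -> : q (size p).-1 = 0 by rewrite horner0 eqxx.
    by apply/polyP => j; rewrite coef0; apply/eqP; have /negP := q0 j; rewrite negbK.
  exists (\poly_(k < size p) (q k)`_j); split.
  + apply: contra_neq qj0 => /(congr1 (fun u : {poly _} => u`_(size p).-1)).
    by rewrite coef_poly coef0 prednK ?leqnn // lt0n size_poly_eq0.
  + by move=> k; rewrite coef_poly; case: ifP => _; [apply: Fq|apply: (subfield0 sF)].
  + rewrite rootE horner_poly; apply/eqP.
    transitivity (r`_j); last by rewrite r0 coef0.
    rewrite coef_sum.
    by apply: eq_bigr => k _; rewrite coefZ mulrC.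
- move=> j; rewrite coef_sum; apply: (subfield_sum sG) => // k _; rewrite coefZ.
  apply: (subfieldM sG) => //; first by apply: (subfieldX sG) => //; apply: gen_field_sub; right.
  by have := Fq k j; apply; [apply: gen_field_subfield|move=> x Sx; apply: gen_field_sub; left].
Qed.

Definition adjs S (s : seq R[i]) := fun x : R[i] => S x \/ x \in s.

(** Induction on [t]: if [x] already depends on [S] and the head [b], then [x] replaces [b];
    otherwise [b] is kept and moves into the base set. *)
Lemma steinitz_exchange S (t : seq R[i]) x :
  gen_closure (adjs S t) x -> ~ gen_closure S x ->
  exists2 t', size t = (size t').+1 &
    forall y, adjs S t y -> gen_closure (adjs (adj S x) t') y.
Proof.
elim: t S => [|b t IH] S xt xS.
  by case: xS; apply: gen_closure_mono xt => y [].
have [xb|xb] := EM (gen_closure (adj S b) x).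
  exists t => // y [Sy|].
    by apply: gen_closure_sub; left; left.
  rewrite inE => /orP[/eqP->|yt]; last by apply: gen_closure_sub; right.
  by apply: gen_closure_mono (gen_closure_exchange xb xS) => z; left.
have [|t' tt' tP] := IH _ _ xb.
  apply: gen_closure_mono xt => y [Sy|]; first by left; left.
  by rewrite inE => /orP[/eqP->|yt]; [left; right|right].
exists (b :: t') => [|y ybt]; first by rewrite /= tt'.
have yt : adjs (adj S b) t y.
  case: ybt => [Sy|]; first by left; left.
  by rewrite inE => /orP[/eqP->|yt]; [left; right|right].
apply: gen_closure_mono (tP y yt) => z [[[Sz|->]|->]|zt].
- by left; left.
- by right; apply: mem_head.
- by left; right.
- by right; rewrite inE zt orbT.
Qed.

(** Either the head of [a] depends on [S], or it is exchanged for an element of [t] and joins [S],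
    which shortens both lists by one. *)
Lemma steinitz_dependent S (t a : seq R[i]) : (size t < size a)%N ->
  (forall x, x \in a -> gen_closure (adjs S t) x) ->
  exists2 j, (j < size a)%N & gen_closure (adjs S (take j a)) a`_j.
Proof.
elim: a S t => [|x a IH] S t // ta aT.
have [xS|xS] := EM (gen_closure S x).
  by exists 0%N => //=; apply: gen_closure_mono xS => y; left.
have [t' tt' tP] := steinitz_exchange (aT x (mem_head _ _)) xS.
have [||j ja aj] := IH (adj S x) t'.
- by rewrite /= tt' in ta.
- move=> y ya; apply: (gen_closure_subset tP).
  by apply: aT; rewrite inE ya orbT.
exists j.+1 => //=; apply: gen_closure_mono aj => y [[Sy|->]|ya].
- by left.
- by right; apply: mem_head.
- by right; rewrite inE ya orbT.
Qed.

(* Polynomials taking the same value at every point that agrees with [x] off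
   the index [i] stand for the polynomials free of the variable [X_i]. *)
Lemma Qalg_indep_gen_closure n (x : 'I_n -> R[i]) (i : 'I_n) : Qalg_indep x ->
  ~ gen_closure (fun y => exists2 j, j != i & y = x j) (x i).
Proof.
move=> xI xi; pose ev v (p : {mpoly rat[n]}) :=
  meval v (map_mpoly (ratr : rat -> R[i]) p).
pose off v := forall j, j != i -> v j = x j.
pose A y := exists2 p : {mpoly rat[n]}, y = ev x p &
  forall v, off v -> ev v p = ev x p.
have rA : is_subring A.
  split.
  - by exists 1 => [|v _]; rewrite /ev !rmorph1.
  - move=> _ _ [p -> pv] [q -> qv]; exists (p - q) => [|v xv].
      by rewrite /ev !rmorphB.
    by rewrite /ev !rmorphB; congr (_ - _); [apply: pv|apply: qv].
  - move=> _ _ [p -> pv] [q -> qv]; exists (p * q) => [|v xv].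
      by rewrite /ev !rmorphM.
    by rewrite /ev !rmorphM; congr (_ * _); [apply: pv|apply: qv].
have evX v j : ev v 'X_j = v j by rewrite /ev map_mpolyX mevalXU.
have SA y : (exists2 j, j != i & y = x j) -> A y.
  by case=> j ji ->; exists 'X_j => [|v xv]; rewrite !evX // xv.
have [p [p0 Ap pxi]] := gen_closure_subring_root rA SA xi.
have /choice[q qP] : forall k, exists q : {mpoly rat[n]},
    p`_k = ev x q /\ forall v, off v -> ev v q = ev x q.
  by move=> k; have [q ? ?] := Ap k; exists q.
pose r := \sum_(k < size p) q k * 'X_i ^+ k.
have evr v : off v -> ev v r = p.[v i].
  move=> xv; have evD : {morph ev v : p q / p + q} by move=> ? ?; rewrite /ev !rmorphD.
  have ev0 : ev v 0 = 0 by rewrite /ev !rmorph0.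
  rewrite (big_morph _ evD ev0) horner_coef; apply: eq_bigr => k _.
  have [-> qv] := qP k; rewrite -(qv v xv) -[v i]evX.
  by rewrite /ev rmorphM rmorphXn /= rmorphM rmorphXn.
have r0 : r = 0 by apply: xI; rewrite -/(ev x r) evr //; apply/rootP.
(* As [r] is zero, [evr] makes [p] vanish at every value given to the coordinate [i]. The naturals
   below [size p] are already too many roots. *)
suff : (size (iota 0 (size p)) < size p)%N by rewrite size_iota ltnn.
rewrite -(size_map (fun k => k%:R : R[i])); apply: max_poly_roots => //.
- apply/allP => _ /mapP[k _ ->]; rewrite rootE.
  pose v j := if j == i then k%:R else x j.
  have xv : off v by move=> j /negbTE ji; rewrite /v ji.
  by have := evr v xv; rewrite r0 /ev !rmorph0 /v eqxx => <-.
- by rewrite map_inj_uniq ?iota_uniq // => j k /eqP; rewrite eqr_nat => /eqP.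
Qed.

(** With fewer than [n] generators, Steinitz exchange over the empty set would put some [x j] in the
    closure of the preceding ones, against independence. *)
Lemma Qalg_indep_size n (x : 'I_n -> R[i]) (t : seq R[i]) :
  Qalg_indep x -> (forall i, gen_closure (fun y => y \in t) (x i)) ->
  (n <= size t)%N.
Proof.
move=> xI xt; rewrite leqNgt; apply/negP => tn.
pose a := [seq x i | i <- enum 'I_n].
have sa : size a = n by rewrite size_map size_enum_ord.
have [||j ja] := @steinitz_dependent (fun=> False) t a.
- by rewrite sa.
- move=> _ /mapP[i _ ->]; apply: gen_closure_mono (xt i) => y; by right.
rewrite sa in ja; have e : a`_j = x (Ordinal ja).
  rewrite (nth_map (Ordinal ja)) ?size_enum_ord //; congr x.
  by apply: val_inj; rewrite /= nth_enum_ord.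
rewrite e => H; apply: (Qalg_indep_gen_closure xI (i := Ordinal ja)).
apply: gen_closure_mono H => y [//|].
rewrite -map_take => /mapP[k kj ->]; exists k => //.
(* The index [j] is not among the first [j] entries of the enumeration, which has no repetition. *)
apply: contraTneq kj => ->.
have -> : Ordinal ja = nth (Ordinal ja) (enum 'I_n) j.
  by apply: val_inj; rewrite /= nth_enum_ord.
rewrite in_take ?index_uniq ?ltnn ?enum_uniq ?size_enum_ord //.
by rewrite mem_nth // size_enum_ord.
Qed.
End GeneratedField.

(** * The complex exponential and the powers of -1 *)

Section ComplexExp.
Variable R : realType.
Implicit Types x y z : R[i].

Lemma CexpD x y : Cexp (x + y) = Cexp x * Cexp y.
Proof.
case: x y => [a b] [c d]; rewrite /Cexp /= expRD cosD sinD.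
by apply/eqP; rewrite eq_complex /=; apply/andP; split; apply/eqP; ring.
Qed.

Lemma Cexp0 : Cexp (0 : R[i]) = 1.
Proof. by rewrite /Cexp /= expR0 cos0 sin0 mulr1 mulr0. Qed.

Lemma Cexp_ipi : Cexp (ipi R) = -1.
Proof.
by rewrite /Cexp /= expR0 cospi sinpi !mul1r; apply/eqP; rewrite eq_complex /= oppr0 !eqxx.
Qed.

Lemma Cexp1 : Cexp (1 : R[i]) = (expR 1)%:C.
Proof. by rewrite /Cexp /= cos0 sin0 mulr1 mulr0. Qed.

Lemma ipi_neq0 : ipi R != 0.
Proof. by rewrite eq_complex /= negb_and (gt_eqF (pi_gt0 R)) orbT. Qed.

Lemma bpow0 : bpow (0 : R[i]) = 1.
Proof. by rewrite /bpow mul0r Cexp0. Qed.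

Lemma bpow1 : bpow (1 : R[i]) = -1.
Proof. by rewrite /bpow mul1r Cexp_ipi. Qed.

Lemma bpowD x y : bpow (x + y) = bpow x * bpow y.
Proof. by rewrite /bpow mulrDl CexpD. Qed.

Lemma bpowN x : bpow (- x) = (bpow x)^-1.
Proof.
have e : bpow (- x) * bpow x = 1 by rewrite -bpowD addNr bpow0.
have x0 : bpow x != 0.
  by apply/eqP => x0; move/eqP: e; rewrite x0 mulr0 eq_sym oner_eq0.
by apply: (mulIf x0); rewrite e mulVf.
Qed.

Lemma bpowMn x n : bpow (x *+ n) = bpow x ^+ n.
Proof. by elim: n => [|n IH]; rewrite ?bpow0 // mulrS bpowD IH exprS. Qed.

End ComplexExp.

(** * Towers of exponents and their transcendence degree *)

Section Towers.
Variable R : realType.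
Implicit Types (x y z : R[i]) (s t : seq R[i]).

(** The field [K] attached to the exponents in [s]; the exponent adjoined last is the head of
    [s]. *)
Definition tower_field s :=
  gen_closure (fun y => exists2 x, x \in s & y = x \/ y = bpow x).

(** The Q-vector space in which linear dependence of exponents is tested. *)
Definition tower_exponent s x := tower_field s x /\ tower_field s (bpow x).

(* Each step adjoins exactly one new element: [bpow x] when [x] is already
   there, [x] when [bpow x] is already there. *)
Fixpoint tower s : Prop :=
  if s is x :: s' then
    [/\ tower s', tower_field s' x \/ tower_field s' (bpow x) &
        ~ tower_exponent s' x]
  else True.

Lemma tower_field_subfield s : is_subfield (tower_field s).
Proof. exact: gen_closure_subfield. Qed.

Lemma tower_field_mono s t z :
  {subset s <= t} -> tower_field s z -> tower_field t z.
Proof. by move=> st; apply: gen_closure_mono => y [x /st xt yx]; exists x. Qed.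

Lemma tower_exponent_mem s x : x \in s -> tower_exponent s x.
Proof. by move=> xs; split; apply: gen_closure_sub; exists x => //; [left|right]. Qed.

Lemma tower_exponent1 s : tower_exponent s 1.
Proof.
have sK := tower_field_subfield s; have K1 := subfield1 sK.
by split => //; rewrite bpow1; apply: (subfieldN sK).
Qed.

Lemma tower_exponentD s x y :
  tower_exponent s x -> tower_exponent s y -> tower_exponent s (x + y).
Proof.
have sK := tower_field_subfield s => -[? ?] [? ?]; split.
  exact: (subfieldD sK).
by rewrite bpowD; apply: (subfieldM sK).
Qed.

Lemma tower_exponentN s x : tower_exponent s x -> tower_exponent s (- x).
Proof.
have sK := tower_field_subfield s => -[? ?]; split; first exact: (subfieldN sK).
by rewrite bpowN; apply: (subfieldV sK).
Qed.

Lemma tower_exponent0 s : tower_exponent s 0.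
Proof.
rewrite -(subrr 1); apply/tower_exponentD/tower_exponentN; exact: tower_exponent1.
Qed.

Lemma tower_exponentMn s x n : tower_exponent s x -> tower_exponent s (x *+ n).
Proof.
move=> Vx; elim: n => [|n IH]; first by rewrite mulr0n; apply: tower_exponent0.
by rewrite mulrS; apply: tower_exponentD.
Qed.

(** [bpow (x / n)] is an [n]-th root of [bpow x], and the tower field is algebraically closed. *)
Lemma tower_exponent_divn s x n : (0 < n)%N ->
  tower_exponent s x -> tower_exponent s (x / n%:R).
Proof.
have sK := tower_field_subfield s => n0 [Kx Kbx]; split.
  apply: (subfieldM sK) => //; apply: (subfieldV sK); exact: (subfield_nat sK).
apply: gen_closure_closed; exists ('X^n - (bpow x)%:P); split.
- by rewrite -size_poly_eq0 size_XnsubC.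
- move=> k; rewrite coefB coefXn coefC; apply: (subfieldB sK).
    exact: (subfield_nat sK).
  by case: ifP => _ //; apply: (subfield0 sK).
- rewrite rootE !hornerE -bpowMn -[_ / _ *+ n]mulr_natr mulfVK ?subrr //.
  by rewrite pnatr_eq0 -lt0n.
Qed.

Lemma tower_exponent_rat s q x :
  tower_exponent s x -> tower_exponent s (ratr q * x).
Proof.
move=> Vx; rewrite /ratr mulrAC -[denq q]gez0_abs ?denq_ge0 // -pmulrn.
apply: tower_exponent_divn; first by rewrite absz_gt0 denq_neq0.
case: (numq q) => n; last (rewrite NegzE mulrNz mulNr; apply: tower_exponentN);
  by rewrite -pmulrn mulr_natl; apply: tower_exponentMn.
Qed.

(** One generator per step suffices: of [x] and [bpow x], one is already algebraic over the earlier
    generators, and the other is added to [t]. *)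
Lemma tower_rank s : tower s -> exists2 t, size t = size s &
  forall z, tower_field s z -> gen_closure (fun y => y \in t) z.
Proof.
elim: s => [_|x s IH /= [ts xs _]].
  exists [::] => // z; apply: gen_closure_mono => y [x].
  by rewrite in_nil.
have [t <- st] := IH ts.
suff [a ax] : exists a, forall y, y = x \/ y = bpow x ->
    gen_closure (fun y => y \in a :: t) y.
  exists (a :: t) => // z; apply: gen_closure_subset => y [u us yu].
  move: us; rewrite inE => /orP[/eqP ux|us]; first by rewrite ux in yu; apply: ax.
  have : gen_closure (fun y => y \in t) y by apply/st/gen_closure_sub; exists u.
  by apply: gen_closure_mono => v vt; rewrite inE vt orbT.
have mono z : tower_field s z -> forall a, gen_closure (fun y => y \in a :: t) z.
  by move=> sz a; apply: gen_closure_mono (st z sz) => v vt; rewrite inE vt orbT.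
by case: xs => [/mono xs|/mono xs]; [exists (bpow x)|exists x] => y [->|->] //;
  apply: gen_closure_sub; apply: mem_head.
Qed.

(** Past the end of the list [nth] returns its default 0, which is an exponent as well. *)
Lemma tower_exponent_nth s i : tower_exponent s (rcons s 1)`_i.
Proof.
rewrite nth_rcons; case: ltnP => [si|_]; first exact/tower_exponent_mem/mem_nth.
by case: ifP => _; [apply: tower_exponent1|apply: tower_exponent0].
Qed.

(** If the coefficient of the head [x] were nonzero, [x] would be a rational combination of
    exponents of the smaller tower, hence one of them. Indexing [c] by naturals lets the induction
    pass to the shifted [c \o succn]. *)
Lemma tower_Qlin_indep s (c : nat -> rat) : tower s ->
  \sum_(i < (size s).+1) ratr (c i) * (rcons s 1)`_i = 0 ->
  forall i, (i <= size s)%N -> c i = 0.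
Proof.
elim: s c => [|x s IH] c /=.
  move=> _; rewrite big_ord_recl big_ord0 addr0 mulr1 => /eqP.
  by rewrite fmorph_eq0 => /eqP c0 [].
move=> [ts xs nxs]; rewrite big_ord_recl /=.
set S := (X in _ + X) => cS.
have VS : tower_exponent s S.
  apply: (big_ind (tower_exponent s)) => [||i _].
  - exact: tower_exponent0.
  - exact: tower_exponentD.
  - exact/tower_exponent_rat/tower_exponent_nth.
have c0 : c 0%N = 0.
  apply/eqP; apply: contraPT nxs => c0 /=; apply.
  have -> : x = ratr (- (c 0%N)^-1) * S.
    move/eqP: cS; rewrite addrC addr_eq0 => /eqP->.
    by rewrite rmorphN mulrNN mulrA -rmorphM mulVf // rmorph1 mul1r.
  exact: tower_exponent_rat.
move=> [//|i]; apply: (IH (c \o succn)) => //.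
by move: cS; rewrite c0 rmorph0 mul0r add0r.
Qed.

Lemma ipi_notin_tower s : Schanuel R -> tower s -> ~ tower_field s (ipi R).
Proof.
move=> sch ts Kpi; have [t st sub] := tower_rank ts.
have sK := tower_field_subfield s.
(* The final entry 1 puts [ipi] itself among the [z i], and [Cexp (z i)] is [bpow] of the [i]-th
   entry. *)
pose z (i : 'I_(size s).+1) := (rcons s 1)`_i * ipi R.
have zI : Qlin_indep z.
  move=> c c0 i; have := @tower_Qlin_indep s (c \o inord) ts _ i.
  rewrite /= inord_val; apply; last by rewrite -ltnS.
  apply: (mulIf (ipi_neq0 R)); rewrite mul0r mulr_suml -[RHS]c0.
  by apply: eq_bigr => j _ /=; rewrite inord_val /z mulrA.
have [f [_ /Qalg_indep_size]] := sch _ _ zI.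
(* The bound would read [size s < size s]. It remains to place each selected number in the tower
   field; [Kpi] serves for those of the form [z i]. *)
move=> /(_ t); rewrite st ltnn => H; suff : false by []; apply: H => k; apply: sub.
case: (f k) => i; last by case: (tower_exponent_nth s i).
by apply: (subfieldM sK) => //; case: (tower_exponent_nth s i).
Qed.

(** * The union of all towers contains the algebraically based numbers *)

Definition tower_union z := exists2 s, tower s & tower_field s z.

Lemma tower_extend s x : tower s -> tower_field s x \/ tower_field s (bpow x) ->
  exists s', [/\ tower s', forall z, tower_field s z -> tower_field s' z &
                 tower_exponent s' x].
Proof.
move=> ts xs; have [Vx|nVx] := EM (tower_exponent s x); first by exists s.
exists (x :: s); split => //.
- by move=> z; apply: tower_field_mono => y ys; rewrite inE ys orbT.
- exact/tower_exponent_mem/mem_head.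
Qed.

(** The steps of [s1] are replayed on top of [s2], skipping exponents already present. The tower
    fields are thus directed, so their union is a field. *)
Lemma tower_merge s1 s2 : tower s1 -> tower s2 -> exists s, [/\ tower s,
  forall z, tower_field s1 z -> tower_field s z &
  forall z, tower_field s2 z -> tower_field s z].
Proof.
move=> + ts2; elim: s1 => [_|x s1 IH /= [ts1 xs _]].
  by exists s2; split => // z; apply: tower_field_mono.
have [s [ts s1s s2s]] := IH ts1.
have [|s' [ts' ss' Vx]] := @tower_extend s x ts.
  by case: xs => /s1s; [left|right].
exists s'; split=> // [z|z /s2s/ss' //]; apply: gen_closure_subset => y [u].
rewrite inE => /orP[/eqP->|us1] yu; first by case: Vx => ? ?; case: yu => ->.
by apply/ss'/s1s/gen_closure_sub; exists u.
Qed.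

Lemma tower_union_subfield : is_subfield tower_union.
Proof.
split.
- by exists [::] => //; apply: (subfield0 (tower_field_subfield _)).
- by exists [::] => //; apply: (subfield1 (tower_field_subfield _)).
- move=> x y [s1 ts1 xs1] [s2 ts2 ys2]; have [s [ts s1s s2s]] := tower_merge ts1 ts2.
  by exists s => //; apply: (subfieldB (tower_field_subfield _)); [apply: s1s|apply: s2s].
- move=> x y [s1 ts1 xs1] [s2 ts2 ys2]; have [s [ts s1s s2s]] := tower_merge ts1 ts2.
  by exists s => //; apply: (subfieldM (tower_field_subfield _)); [apply: s1s|apply: s2s].
- by move=> x [s ts xs] _; exists s => //; apply: (subfieldV (tower_field_subfield _)).
Qed.

Lemma tower_union_closed z : alg_closure tower_union z -> tower_union z.
Proof.
move=> [p [p0 Up pz]].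
(* The coefficients are finite in number, so successive merging puts them all in a single tower
   field. *)
have [s ts ps] : exists2 s, tower s &
    forall k, (k < size p)%N -> tower_field s p`_k.
  elim: (size p) => [|n [s1 ts1 ps1]]; first by exists [::].
  have [s2 ts2 ps2] := Up n; have [s [ts s1s s2s]] := tower_merge ts1 ts2.
  exists s => // k; rewrite ltnS leq_eqVlt => /orP[/eqP->|/ps1/s1s //].
  exact: s2s.
exists s => //; apply: gen_closure_closed; exists p; split=> // k.
have [/ps //|/(nth_default 0) ->] := ltnP k (size p).
exact: (subfield0 (tower_field_subfield s)).
Qed.

(** Whichever of [x] and [bpow x] a tower field contains, extending the tower by [x] brings in
    both. *)
Lemma tower_union_bpow x : tower_union x <-> tower_union (bpow x).
Proof.
split=> -[s ts xs].
  by have [|s' [ts' _ []]] := @tower_extend s x ts; [left|exists s'].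
by have [|s' [ts' _ []]] := @tower_extend s x ts; [right|exists s'].
Qed.

(** By induction on the level: the union is an algebraically closed field stable under [bpow] in
    both directions, so it absorbs every stage. *)
Lemma ELalg_tower_union z : ELalg z -> tower_union z.
Proof.
have sU := tower_union_subfield.
case=> n; elim: n z => [z [q ->]|n IH z /=]; first exact: (subfield_rat sU).
apply: gen_closure_min => //; first exact: tower_union_closed.
move=> x [/IH //|[y [/IH Uy ->]]|/IH Ux].
  by case: (tower_union_bpow y) => + _; apply.
by case: (tower_union_bpow x) => _; apply.
Qed.

Lemma algebraicQ_tower_union z : algebraicQ z -> tower_union z.
Proof.
have sU := tower_union_subfield.
case=> p [p0 pz]; apply: tower_union_closed.
exists (map_poly ratr p); split=> //; first by rewrite map_poly_eq0.
by move=> k; rewrite coef_map; apply: (subfield_rat sU).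
Qed.

(** * Logarithms outside the union of towers *)

Lemma log_notin_tower_union x : Schanuel R ->
  x != 0 -> tower_union (Cexp x) -> ~ tower_union x.
Proof.
move=> sch x0 Uex Ux; have sU := tower_union_subfield.
have Uq : tower_union (x / ipi R).
  by apply/tower_union_bpow; rewrite /bpow divfK // ipi_neq0.
suff [s ts] : tower_union (ipi R) by apply: ipi_notin_tower.
have -> : ipi R = x / (x / ipi R) by rewrite invf_div mulrC divfK.
by apply: (subfieldM sU) => //; apply: (subfieldV sU).
Qed.

(** This serves to pass from [pi] to [ipi]. *)
Lemma tower_union_i : tower_union 'i.
Proof.
apply: algebraicQ_tower_union; exists ('X^2 + 1%:P); split.
  by rewrite -size_poly_eq0 size_XnaddC.
rewrite rmorphD /= map_polyXn map_polyC /= rmorph1 rootE !hornerE.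
by rewrite sqr_i addNr.
Qed.
End Towers.

Theorem theorem11p5 (R : realType) :
  Schanuel R ->
  [/\ (forall b L : R[i], algebraicQ b -> b != 0 -> b != 1 ->
          L != 0 -> Cexp L = b -> ~ ELalg L),
      ~ ELalg ((pi : R)%:C),
      ~ ELalg ((expR (1 : R))%:C) &
      (forall a L : R[i], ELalg a -> a != 0 -> a != 1 ->
          Cexp L = a -> ~ ELalg L)].
Proof.
move=> sch; have sU := tower_union_subfield R; split.
- move=> b L /algebraicQ_tower_union Ub _ _ L0 Lb /ELalg_tower_union.
  by apply: log_notin_tower_union => //; rewrite Lb.
- move=> /ELalg_tower_union Upi.
  (* [ipi] is a nonzero logarithm of -1. *)
  apply: (log_notin_tower_union sch (ipi_neq0 R)).
    by rewrite Cexp_ipi; apply: (subfieldN sU); apply: (subfield1 sU).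
  have -> : ipi R = 'i * (pi : R)%:C.
    by apply/eqP; rewrite eq_complex /= !mul0r !mul1r subr0 add0r !eqxx.
  exact: (subfieldM sU (tower_union_i R)).
- move=> /ELalg_tower_union Ue.
  (* The roles are reversed here: the logarithm 1 of e lies in the union, so e cannot. *)
  apply: (log_notin_tower_union sch (oner_neq0 R[i])); last exact: (subfield1 sU).
  by rewrite Cexp1.
- move=> a L /ELalg_tower_union Ua _ a1 La /ELalg_tower_union.
  apply: log_notin_tower_union => //; last by rewrite La.
  (* The assumption that [a] is not 1 is what makes [L] nonzero. *)
  by apply: contra_neq a1 => L0; rewrite -La L0 Cexp0.
Qed.
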